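(* There exists $s_0$ such that the following holds for any integer $s\ge s_0$. For any positive integers $n,k,d$ satisfying $1\le d\le k-1$, $n\ge k(s+1)$ and $n-d\ge\frac53(k-d)s-\frac23 s$ we have $$m_d^*(n,k,s)=\binom{n-d}{k-d}-\binom{n-s-d}{k-d}.$$
   Context: For $\mathcal F\subset\binom{[n]}k$ (a family of $k$-element subsets of $[n]=\{1,\dots,n\}$), a fractional matching is a function $w:\mathcal F\to[0,1]$ with $\sum_{F\in\mathcal F:\,i\in F}w(F)\le1$ for every $i\in[n]$; its size is $\sum_{F\in\mathcal F}w(F)$, and $\nu^*(\mathcal F)$ is the maximum size of a fractional matching in $\mathcal F$. The minimal $d$-degree is $\delta_d(\mathcal F)=\min_{S\in\binom{[n]}d}|\{F\in\mathcal F:S\subset F\}|$. Define $m_d^*(n,k,s)=\max\{\delta_d(\mathcal F):\mathcal F\subset\binom{[n]}k,\ \nu^*(\mathcal F)<s+1\}$. *)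

(* Defs.v *)
(* World: MathComp, with the real numbers (realType) and suprema of
   MathComp-Analysis.  The ground set [n] is 'I_n. *)
From mathcomp Require Import all_boot all_order all_algebra.
From mathcomp Require Import classical_sets reals.

Set Implicit Arguments.
Unset Strict Implicit.
Unset Printing Implicit Defensive.

Import Order.TTheory GRing.Theory Num.Theory.

Local Open Scope ring_scope.

Definition uniform_family (n k : nat) (F : {set {set 'I_n}}) : bool :=
  [forall A in F, #|A| == k].

(* A weight function on F is a function on all subsets of 'I_n of which only
   the values on F are ever used. *)
Definition fractional_matching (R : realType) (n : nat)
    (F : {set {set 'I_n}}) (w : {set 'I_n} -> R) : Prop :=
  (forall A, A \in F -> 0 <= w A <= 1) /\
  (forall i : 'I_n, \sum_(A in F | i \in A) w A <= 1).

Definition weight_size (R : realType) (n : nat)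
    (F : {set {set 'I_n}}) (w : {set 'I_n} -> R) : R :=
  \sum_(A in F) w A.

(* The set of sizes contains 0 and is bounded by #|F|, so sup is the genuine
   least upper bound; by compactness it is attained, i.e. it is the maximum. *)
Definition nu_star (R : realType) (n : nat) (F : {set {set 'I_n}}) : R :=
  sup [set weight_size F w | w in @fractional_matching R n F]%classic.

Definition degree (n : nat) (F : {set {set 'I_n}}) (S : {set 'I_n}) : nat :=
  #|[set A in F | S \subset A]|.

(* Every degree is at most #|F|, so this initial value does not affect the
   minimum as soon as d <= n. *)
Definition min_degree (n d : nat) (F : {set {set 'I_n}}) : nat :=
  \big[minn/#|F|]_(S : {set 'I_n} | #|S| == d) degree F S.

(* The family F = set0 satisfies the constraint, so the maximum is over a
   nonempty set. *)
Definition m_star (R : realType) (d n k s : nat) : nat :=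
  \max_(F : {set {set 'I_n}} |
        uniform_family k F && (nu_star R F < s%:R + 1)) min_degree d F.

(* Main.v *)
(** By linear programming duality a family with fractional matching number
below [s + 1] carries vertex weights [v >= 0] of total less than [s + 1] giving
every member weight at least 1.  Let [S] consist of the [d] lightest vertices and
let [b] be their mean weight: off [S], the weights [(v - b) / (1 - k b)] still have
total less than [s + 1], because [n >= k (s + 1)].  So it suffices to show that if
[N = n - d] points have total weight less than [s + 1], then at least [C(N - s, l)]
of their [l]-subsets, [l = k - d], have weight less than 1.

Split off the [s + 1] heaviest points [x_i] and put [a_i = 1 - w(x_i)],
[a = max a_i].  Let [Y] be the weight of a random [(l - 1)]-subset of the remaining
[M] points, and let [W] be their total weight, so that [W < sum a_i].  Counting the
light [l]-sets that contain at most one of the [x_i] reduces the claim to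
[sum_i P(Y < a_i) >= 1 + W P(Y >= a)].

If [W] is at most about [2 s / 3], this holds on average over random families
of about [M / (l - 1)] disjoint [(l - 1)]-sets, as in Frankl's proof of the matching
conjecture for [n >= (2 s + 1) k - s].  Otherwise [a >= 0.66] and [E Y <= 0.601 a];
Markov's inequality for the [a_i] reduces the claim to [a P(Y >= a) <= 0.398].  As
the remaining points weigh at most [u = 1 - a], this follows from Chebyshev's
inequality for [a >= 0.79], and for smaller [a] from the bound
[E min(Y, u) >= u (1 - exp(- E Y / u))]. *)
Require Import Defs.
From mathcomp Require Import all_boot all_order all_algebra.
From mathcomp Require Import classical_sets reals.
(* Reimported to take precedence over the homonyms of classical_sets. *)
From mathcomp Require Import fintype finset perm.
From mathcomp Require Import ring lra zify.

Set Implicit Arguments.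
Unset Strict Implicit.
Unset Printing Implicit Defensive.

Import Order.TTheory GRing.Theory Num.Theory.

Local Open Scope ring_scope.

(** * Averages over k-subsets *)

Lemma card_draws_superset (T : finType) (B : {set T}) (k : nat) :
  (#|B| <= k)%N ->
  #|[set A : {set T} | (#|A| == k) && (B \subset A)]| = 'C(#|T| - #|B|, k - #|B|).
Proof.
move=> leBk; have <- : #|~: B| = (#|T| - #|B|)%N by rewrite -(cardsC B) addKn.
rewrite -cards_draws; set D := [set A : {set T} | A \subset _ & _].
rewrite -(card_in_imset (f := fun A : {set T} => A :|: B) (D := D)); last first.
  move=> A A'; rewrite !inE => /andP[sA _] /andP[sA' _] eqA.
  have restr (C : {set T}) : C \subset ~: B -> C = (C :|: B) :&: ~: B.
    by move=> sC; rewrite setIUl setICr setU0; apply/esym/setIidPl.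
  by rewrite (restr A) // (restr A') // eqA.
apply: eq_card => A; rewrite inE; apply/idP/imsetP => [/andP[/eqP cA sBA]|[C]].
  exists (A :\: B); last by rewrite setDE setUIl (setUC (~: B)) setUCr setIT; apply/esym/setUidPl.
  by rewrite inE -setTD setSD ?subsetT // cardsDS // cA eqxx.
rewrite inE => /andP[sC /eqP cC] ->; rewrite subsetUr andbT cardsU.
suff -> : C :&: B = set0 by rewrite cards0 subn0 cC subnK.
by apply/eqP; rewrite setI_eq0 disjoints_subset.
Qed.

Lemma sum_draws_mem (R : comNzRingType) (T : finType) (k : nat) (f : T -> R) :
  #|T|%:R * \sum_(A : {set T} | #|A| == k) \sum_(x in A) f x
  = k%:R * 'C(#|T|, k)%:R * \sum_x f x.
Proof.
case: k => [|k].
  rewrite !mul0r big1 ?mulr0 // => A.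
  by rewrite cards_eq0 => /eqP->; rewrite big_set0.
rewrite (exchange_big_dep xpredT) //= mulr_sumr mulr_sumr; apply: eq_bigr => x _.
rewrite sumr_const -[f x *+ _]mulr_natl mulrA.
rewrite -(@eq_card _ [set A : {set T} | (#|A| == k.+1) && ([set x] \subset A)]).
  by rewrite card_draws_superset cards1 // !subn1 -!natrM mul_bin_diag.
by move=> A; rewrite !inE sub1set.
Qed.

Lemma sum_draws_sqr (R : realFieldType) (T : finType) (k : nat) (f : T -> R) (u : R) :
  (0 < k <= #|T|)%N -> (forall x, 0 <= f x <= u) ->
  let m := k%:R * (\sum_x f x) / #|T|%:R in
  \sum_(A : {set T} | #|A| == k) (\sum_(x in A) f x) ^+ 2
  <= 'C(#|T|, k)%:R * (m ^+ 2 + u * m).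
Proof.
move=> /andP[k0 kM] fu; set M := #|T|; set W := \sum_x f x => /=; set m := _ / _.
have f0 x : 0 <= f x by case/andP: (fu x).
have M0 : 0 < M%:R :> R by rewrite ltr0n (leq_trans k0).
have sumY : \sum_(A : {set T} | #|A| == k) \sum_(x in A) f x = 'C(M, k)%:R * m.
  apply: (mulfI (lt0r_neq0 M0)); rewrite sum_draws_mem /m -/W -/M.
  by rewrite mulrCA [k%:R * _ / _]mulrC mulVKf ?lt0r_neq0 // mulrCA mulrA.
pose offdiag (A : {set T}) := \sum_(x in A) \sum_(y in A | y != x) f x * f y.
have split2 (A : {set T}) : (\sum_(x in A) f x) ^+ 2 <= u * \sum_(x in A) f x + offdiag A.
  rewrite expr2 mulr_suml mulr_sumr -big_split; apply: ler_sum => x xA.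
  rewrite mulr_sumr (bigD1 x) //= lerD2r ler_wpM2r //.
  by case/andP: (fu x).
apply: le_trans (ler_sum _ (fun A _ => split2 A)) _.
rewrite big_split /= -mulr_sumr sumY mulrDr addrC mulrCA lerD2r.
case: k k0 kM @m sumY => [//|[|k]] _ kM m sumY.
  rewrite big1 => [|A /cards1P[z ->]]; first by apply: mulr_ge0; rewrite ?sqr_ge0.
  apply: big1 => x; rewrite inE => /eqP->; apply: big1 => y.
  by rewrite inE => /andP[->].
pose c2 := 'C(M - 2, k)%:R : R.
have -> : \sum_(A : {set T} | #|A| == k.+2) offdiag A
    = \sum_x \sum_(y | y != x) c2 * (f x * f y).
  rewrite (exchange_big_dep xpredT) //=; apply: eq_bigr => x _.
  rewrite (exchange_big_dep (fun y => y != x)) /=; last by move=> A y _ /andP[].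
  apply: eq_bigr => y yx; rewrite sumr_const -mulr_natl; congr (_%:R * _).
  rewrite -[RHS](_ : #|[set A : {set T} | (#|A| == k.+2) && ([set x; y] \subset A)]| = _).
    by rewrite -cardsE; apply: eq_card => A; rewrite !inE subUset !sub1set unfold_in yx andbT andbA.
  have cxy : #|[set x; y]| = 2 by rewrite cards2 eq_sym yx.
  by rewrite card_draws_superset cxy // !subSS subn0.
apply: (@le_trans _ _ (c2 * W ^+ 2)).
  rewrite expr2 mulr_suml mulr_sumr; apply: ler_sum => x _.
  rewrite -mulr_sumr ler_wpM2l // mulr_sumr [leRHS](bigD1 x) //=.
  by rewrite lerDr mulr_ge0.
have M2 : (2 <= M)%N by apply: leq_trans kM.
have cM : (M * (M - 1) * 'C(M - 2, k) = k.+2 * k.+1 * 'C(M, k.+2))%N.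
  by rewrite -mulnA subn1 subn2 mul_bin_diag mulnCA mul_bin_diag mulnCA mulnA.
have key : ('C(M - 2, k) * M ^ 2 <= 'C(M, k.+2) * k.+2 ^ 2)%N.
  rewrite -(@leq_pmul2r (M - 1)) ?subn_gt0 //.
  have -> : ('C(M - 2, k) * M ^ 2 * (M - 1) = 'C(M, k.+2) * k.+2 * (M * k.+1))%N.
    have -> : ('C(M - 2, k) * M ^ 2 * (M - 1) = M * (M * (M - 1) * 'C(M - 2, k)))%N.
      by rewrite -mulnn; move: (M - 1)%N => ?; ring.
    by rewrite cM; ring.
  have -> : ('C(M, k.+2) * k.+2 ^ 2 * (M - 1) = 'C(M, k.+2) * k.+2 * (k.+2 * (M - 1)))%N.
    by rewrite -mulnn !mulnA.
  rewrite leq_mul2l; apply/orP; right.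
  by move: kM M2; rewrite -/M; clear; move: M => M; nia.
rewrite /m -/M -/W expr_div_n [leRHS]mulrA ler_pdivlMr ?exprn_gt0 //.
rewrite exprMn mulrAC [leRHS]mulrA ler_wpM2r ?sqr_ge0 //.
by rewrite -!natrX -!natrM ler_nat.
Qed.

Lemma chebyshev_sum (R : realDomainType) (T : finType) (f g : T -> R) :
  (forall x y, f x <= f y -> g y <= g x) ->
  #|T|%:R * \sum_x f x * g x <= (\sum_x f x) * \sum_x g x.
Proof.
move=> anti.
have : \sum_x \sum_y (f x - f y) * (g x - g y) <= 0.
  apply: sumr_le0 => x _; apply: sumr_le0 => y _.
  case: (lerP (f x) (f y)) => fxy.
    by rewrite mulr_le0_ge0 ?subr_le0 ?subr_ge0 ?anti.
  by rewrite mulr_ge0_le0 ?subr_le0 ?subr_ge0 ?anti ?(ltW fxy).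
have -> : \sum_x \sum_y (f x - f y) * (g x - g y)
    = (#|T|%:R * \sum_x f x * g x - (\sum_x f x) * \sum_x g x) *+ 2.
  pose h x y := f x * g y.
  have -> : \sum_x \sum_y (f x - f y) * (g x - g y)
      = \sum_x \sum_y (h x x + h y y) - \sum_x \sum_y (h x y + h y x).
    rewrite -sumrB; apply: eq_bigr => x _; rewrite -sumrB.
    by apply: eq_bigr => y _; rewrite /h; ring.
  have -> : \sum_x \sum_y (h x x + h y y) = (#|T|%:R * \sum_x h x x) *+ 2.
    under eq_bigr => x _ do rewrite big_split sumr_const /=.
    by rewrite big_split /= sumr_const sumrMnl mulr2n mulr_natl.
  have -> : \sum_x \sum_y (h x y + h y x) = ((\sum_x f x) * \sum_x g x) *+ 2.
    under eq_bigr => x _ do rewrite big_split /=.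
    rewrite big_split /= [X in _ + X]exchange_big /= -mulr2n; congr (_ *+ _).
    by rewrite mulr_suml; apply: eq_bigr => x _; rewrite mulr_sumr.
  by rewrite mulrnBl.
by rewrite pmulrn_lle0 // subr_le0.
Qed.

Lemma sum_draws_prod (R : realFieldType) (T : finType) (k : nat) (z : T -> R) :
  (k <= #|T|)%N -> (forall x, 0 <= z x) ->
  \sum_(A : {set T} | #|A| == k) \prod_(x in A) z x
  <= 'C(#|T|, k)%:R * ((\sum_x z x) / #|T|%:R) ^+ k.
Proof.
move=> + z0; elim: k => [_|k IH kM].
  rewrite (big_pred1 set0) => [|A]; last by rewrite cards_eq0.
  by rewrite big_set0 bin0 expr0 mulr1.
have M0 : 0 < #|T|%:R :> R by rewrite ltr0n (leq_trans _ kM).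
pose e j := \sum_(A : {set T} | #|A| == j) \prod_(x in A) z x.
pose g x := \sum_(A : {set T} | (#|A| == k) && (x \notin A)) \prod_(y in A) z y.
have e_succ : k.+1%:R * e k.+1 = \sum_x z x * g x.
  rewrite /e mulr_sumr; under [RHS]eq_bigr => x _ do rewrite mulr_sumr.
  rewrite (exchange_big_dep (fun A : {set T} => #|A| == k)) /=; last by move=> x A _ /andP[].
  transitivity (\sum_(B : {set T} | #|B| == k.+1) \sum_(x in B) \prod_(y in B) z y).
    by apply: eq_bigr => B /eqP cB; rewrite sumr_const cB mulr_natl.
  rewrite (exchange_big_dep xpredT) //= [RHS](exchange_big_dep xpredT) //=.
  apply: eq_bigr => x _.
  rewrite (reindex_onto (fun A => x |: A) (fun B => B :\ x)) /=; last first.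
    by move=> B /andP[_ xB]; rewrite setD1K.
  apply: eq_big => [A|A /andP[/andP[_ _] /eqP xA]].
    rewrite setU11 andbT [RHS]andbA andbb; case: (boolP (x \in A)) => xA.
      apply/idP/andP => [/andP[_ /eqP eqA]|[]//].
      by move: xA; rewrite -eqA !inE eqxx.
    by rewrite cardsU1 xA add1n eqSS setU1K // eqxx !andbT.
  by rewrite big_setU1 // -xA !inE eqxx.
have sum_g : \sum_x g x = (#|T| - k)%:R * e k.
  rewrite /g (exchange_big_dep (fun A : {set T} => #|A| == k)) /=; last by move=> x A _ /andP[].
  rewrite mulr_sumr; apply: eq_bigr => A /eqP cA.
  rewrite sumr_const mulr_natl -cA; congr (_ *+ _).
  rewrite -(cardsC A) addKn; apply: eq_card => x.
  by rewrite unfold_in inE eqxx.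
have anti x y : z x <= z y -> g y <= g x.
  move=> zxy; rewrite /g (reindex_inj (imset_inj (@perm_inj _ (tperm x y)))) /=.
  have im_x (A : {set T}) : (y \in tperm x y @: A) = (x \in A).
    by rewrite -{1}(tpermL x y) mem_imset //; apply: perm_inj.
  under eq_bigl => A do rewrite im_x (card_imset _ (@perm_inj _ (tperm x y))).
  apply: ler_sum => A /andP[_ xA]; rewrite big_imset /=; last by move=> ? ? _ _; apply: perm_inj.
  apply: ler_prod => v vA; rewrite z0 /=.
  by case: tpermP => // [eqv|->] //; rewrite -eqv vA in xA.
have := chebyshev_sum anti; rewrite -e_succ sum_g => step.
have d0 : 0 < #|T|%:R * k.+1%:R :> R by apply: mulr_gt0; rewrite // ltr0n.
rewrite -(ler_pM2l d0) -[leLHS]mulrA; apply: le_trans step _.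
apply: (@le_trans _ _ ((\sum_x z x) * ((#|T| - k)%:R *
    ('C(#|T|, k)%:R * ((\sum_x z x) / #|T|%:R) ^+ k)))).
  by rewrite ler_wpM2l ?sumr_ge0 // ler_wpM2l ?ler0n // IH // ltnW.
have cR : (#|T| - k)%:R * 'C(#|T|, k)%:R = k.+1%:R * 'C(#|T|, k.+1)%:R :> R.
  by rewrite -!natrM mul_bin_left.
rewrite [(#|T| - k)%:R * (_ * _)]mulrA cR exprS le_eqVlt; apply/orP; left; apply/eqP.
move: (_ ^+ k) => Q; move: (\sum_x z x) => S; field.
by rewrite lt0r_neq0.
Qed.

Lemma pow_one_minus_mul_le1 (R : realFieldType) (n k : nat) (x : R) :
  (0 < n)%N -> (0 < k)%N -> 0 <= x <= k%:R ->
  (1 - x / k%:R) ^+ k * (1 + x / n%:R) ^+ n <= 1.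
Proof.
move=> n0 k0 /andP[x0 xk].
pose E (i : 'I_k + 'I_n) := if i is inl _ then 1 - x / k%:R else 1 + x / n%:R.
have kp : 0 < k%:R :> R by rewrite ltr0n.
have np : 0 < n%:R :> R by rewrite ltr0n.
have [|] := @leif_AGM R _ [pred i | true] E.
  move=> [i|i] _ /=; last by rewrite addr_ge0 // divr_ge0 // ltW.
  by rewrite subr_ge0 ler_pdivrMr // mul1r.
rewrite !big_sumType /= !prodr_const !sumr_const !card_ord => + _.
move=> /le_trans; apply; rewrite card_sum !card_ord.
suff -> : (1 - x / k%:R) *+ k + (1 + x / n%:R) *+ n = (k + n)%:R.
  by rewrite divff ?expr1n // pnatr_eq0 addn_eq0 negb_and -!lt0n k0.
rewrite -[_ *+ k]mulr_natl -[_ *+ n]mulr_natl natrD; field.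
by rewrite !lt0r_neq0.
Qed.

(** * Random disjoint sets *)

Lemma perm_imset_onto (T : finType) (A B : {set T}) :
  #|A| = #|B| -> exists s : {perm T}, s @: A = B.
Proof.
have [n] := ubnP #|A :\: B|; elim: n A => // n IH A leAn cAB.
have [AB|[x]] := set_0Vmem (A :\: B).
  exists 1%g; have -> : (1%g : {perm T}) @: A = A.
    by rewrite (eq_imset (g := id)) ?imset_id // => x; rewrite perm1.
  by apply/eqP; rewrite eqEcard cAB leqnn andbT -setD_eq0 AB.
rewrite inE => /andP[xB xA].
have [BA|[y]] := set_0Vmem (B :\: A).
  have sBA : B \subset A by rewrite -setD_eq0 BA.
  have /eqP eBA : B == A by rewrite eqEcard sBA cAB leqnn.
  by rewrite eBA xA in xB.
rewrite inE => /andP[yA yB].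
have xy : x != y by apply: contraNneq yA => <-.
pose A' := tperm x y @: A.
have memA' z : z \in A' -> z \in A :\ x \/ z = y.
  case/imsetP => v vA ->; case: tpermP => [_|eqv|vx vy]; first by right.
    by rewrite -eqv vA in yA.
  by left; rewrite !inE vA andbT; apply/eqP.
have [||s sA'] := IH A'; last 1 first.
- exists (tperm x y * s)%g; rewrite -sA' /A' -imset_comp.
  by apply: eq_imset => z; rewrite permM.
- rewrite -ltnS; apply: leq_trans leAn; rewrite ltnS; apply: proper_card.
  apply/properP; split.
    apply/subsetP => z; rewrite !inE => /andP[zB /memA' [|ezy]].
      by rewrite !inE zB => /andP[].
    by rewrite ezy yB in zB.
  exists x; rewrite !inE ?xB ?xA //=; apply/negP => /memA'[|exy].
    by rewrite !inE eqxx.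
  by rewrite exy eqxx in xy.
- by rewrite card_imset //; apply: perm_inj.
Qed.

Lemma sum_perm_imset (R : comNzRingType) (T : finType) (B0 : {set T}) :
  exists2 c : nat, (0 < c)%N & forall (B : {set T}) (g : {set T} -> R), #|B| = #|B0| ->
  \sum_(s : {perm T}) g (s @: B) = c%:R * \sum_(A : {set T} | #|A| == #|B0|) g A.
Proof.
pose N (B A : {set T}) := #|[set s : {perm T} | s @: B == A]|.
have imM (s t : {perm T}) (A : {set T}) : (s * t)%g @: A = t @: (s @: A).
  by rewrite -imset_comp; apply: eq_imset => x; rewrite permM.
have leN (B A B' A' : {set T}) : #|B| = #|B0| -> #|A| = #|B0| -> #|B'| = #|B0| -> #|A'| = #|B0| ->
    (N B A <= N B' A')%N.
  move=> cB cA cB' cA'.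
  have [al alB] : exists s : {perm T}, s @: B' = B by apply: perm_imset_onto; rewrite cB.
  have [be beA] : exists s : {perm T}, s @: A = A' by apply: perm_imset_onto; rewrite cA.
  have inj : injective (fun s : {perm T} => al * s * be)%g.
    by move=> s s' /mulIg/mulgI.
  rewrite /N -(card_imset _ inj); apply: subset_leq_card.
  apply/subsetP => _ /imsetP[s + ->]; rewrite !inE => /eqP sB.
  by rewrite !imM alB sB beA.
exists (N B0 B0).
  rewrite /N card_gt0; apply/set0Pn; exists 1%g; rewrite inE.
  by rewrite (eq_imset (g := id)) ?imset_id // => x; rewrite perm1.
move=> B g cB.
rewrite (partition_big (fun s : {perm T} => s @: B) (fun A => #|A| == #|B0|)) /=; last first.
  by move=> s _; rewrite card_imset ?cB //; apply: perm_inj.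
rewrite mulr_sumr; apply: eq_bigr => A /eqP cA.
rewrite (eq_bigr (fun _ => g A)) => [|s /eqP-> //].
rewrite sumr_const -[g A *+ _]mulr_natl; congr (_%:R * _).
rewrite -cardsE; apply/eqP; rewrite eqn_leq.
by rewrite [X in (X <= _)%N](_ : _ = N B A) // !leN.
Qed.

Lemma sum_le_of_count_le (R : realDomainType) (I J : finType) (a : I -> R) (Y : J -> R) :
  (forall j, 0 <= Y j) ->
  (forall i, (#|[set i' | (a i <= a i')%R]| <= #|[set j | (a i <= Y j)%R]|)%N) ->
  \sum_i a i <= \sum_j Y j.
Proof.
move=> Y0 cnt.
suff main (n : nat) (A : {set I}) (B : {set J}) : #|A| = n ->
    (forall i, i \in A ->
      (#|[set i' in A | (a i <= a i')%R]| <= #|[set j in B | (a i <= Y j)%R]|)%N) ->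
    \sum_(i in A) a i <= \sum_(j in B) Y j.
  rewrite (eq_bigl (mem [set: I])) => [|i]; last by rewrite /= in_setT.
  rewrite [leRHS](eq_bigl (mem [set: J])) => [|j]; last by rewrite /= in_setT.
  apply: main erefl _ => i _; apply: leq_trans (leq_trans _ (cnt i)) _;
    by apply: subset_leq_card; apply/subsetP => v; rewrite !inE.
elim: n A B => [|n IH] A B cA cntA.
  by move/eqP: cA; rewrite cards_eq0 => /eqP->; rewrite big_set0 sumr_ge0.
have /set0Pn[i1 i1A] : A != set0 by rewrite -card_gt0 cA.
have [i0 i0A maxi0] : exists2 i0, i0 \in A & forall i, i \in A -> a i <= a i0.
  by case: (arg_maxP a i1A) => i0 ? ?; exists i0.
have /card_gt0P[j0] : (0 < #|[set j in B | (a i0 <= Y j)%R]|)%N.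
  apply: leq_trans (cntA _ i0A); apply/card_gt0P; exists i0.
  by rewrite !inE i0A lexx.
rewrite !inE => /andP[j0B le_ij].
rewrite (big_setD1 i0) //= (big_setD1 j0 j0B) /= lerD //.
apply: IH; first by move: cA; rewrite (cardsD1 i0) i0A => -[].
move=> i; rewrite !inE => /andP[_ iA]; have := cntA _ iA.
rewrite (cardsD1 i0) (cardsD1 j0 [set _ in B | _]) !inE i0A j0B maxi0 //=.
rewrite (le_trans (maxi0 _ iA) le_ij) !add1n ltnS => le_c.
apply: leq_trans (leq_trans _ le_c) _; apply: subset_leq_card; apply/subsetP => v.
  by rewrite !inE andbA.
by rewrite !inE andbA.
Qed.

Lemma block_injection (T : finType) (t k : nat) : (t * k <= #|T|)%N ->
  exists h : 'I_t * 'I_k -> T, injective h.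
Proof.
move=> tk; have cE : #|{: 'I_t * 'I_k}| = (t * k)%N by rewrite card_prod !card_ord.
exists (fun p => enum_val (widen_ord tk (cast_ord cE (enum_rank p)))).
by move=> p q /enum_val_inj /(congr1 val) /= /val_inj/enum_rank_inj.
Qed.

(* For disjoint [B_1, ..., B_t] the weights sum up to less than [\sum_i a i], so for some [i] fewer
   [B_j] than [a i'] reach the value [a i]; this yields the inequality summed over the [B_j].  The
   images of the [B_j] under a random permutation then average it over all k-sets. *)
Lemma tails_ge_of_disjoint_sets (R : realFieldType) (T I : finType) (w : T -> R)
    (a : I -> R) (amax : R) (k t : nat) (W := \sum_x w x) :
  (forall x, 0 <= w x) -> (forall i, a i <= amax) -> W < \sum_i a i ->
  (0 < k)%N -> (t * k <= #|T|)%N -> #|I|%:R + W <= t%:R ->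
  \sum_(A : {set T} | #|A| == k) (1 + W * (amax <= \sum_(x in A) w x)%R%:R)
  <= \sum_(A : {set T} | #|A| == k) \sum_i (\sum_(x in A) w x < a i)%R%:R.
Proof.
move=> w0 aM Wa k0 tkT tW.
have W0 : 0 <= W by apply: sumr_ge0.
pose f (y : R) := \sum_i (y < a i)%R%:R - (1 + W * (amax <= y)%R%:R).
have pointwise (Y : 'I_t -> R) : (forall j, 0 <= Y j) -> \sum_j Y j <= W -> 0 <= \sum_j f (Y j).
  move=> Y0 YW.
  have /existsP[i] : [exists i, (#|[set j | (a i <= Y j)%R]| < #|[set i' | (a i <= a i')%R]|)%N].
    rewrite -[X in is_true X]negbK negb_exists; apply/negP => /forallP cnt.
    have := le_lt_trans YW Wa; rewrite ltNge sum_le_of_count_le // => i.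
    by rewrite leqNgt.
  set J := [set j | _]; set r := #|[set i' | (a i <= a i')%R]| => ltJr.
  have rI : (r <= #|I|)%N by apply: max_card.
  have out j : j \notin J -> r%:R - 1 <= f (Y j).
    rewrite inE -ltNge => Yj; rewrite /f (lt_geF (lt_le_trans Yj (aM i))) mulr0 addr0 lerD2r.
    rewrite -natr_sum ler_nat /r -sum1dep_card big_mkcond /=; apply: leq_sum => i' _.
    by case: ifP => // ai; rewrite (lt_le_trans Yj).
  have inJ j : - (1 + W) <= f (Y j).
    rewrite /f -[leLHS]add0r lerD //; first by apply: sumr_ge0 => i' _; rewrite ler0n.
    by rewrite lerN2 lerD2l ler_piMr // lern1 leq_b1.
  rewrite (bigID (mem J)) /=.
  apply: (@le_trans _ _ (\sum_(j in J) - (1 + W) + \sum_(j | j \notin J) (r%:R - 1))); last first.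
    by apply: lerD; apply: ler_sum => j; [move=> _; apply: inJ | apply: out].
  rewrite !sumr_const (_ : #|[pred j | j \notin J]| = (t - #|J|)%N); last first.
    transitivity #|~: J|; first by apply: eq_card => j; rewrite in_setC.
    by rewrite cardsCs setCK card_ord.
  have Jt : (#|J| <= t)%N by rewrite -[X in (_ <= X)%N]card_ord max_card.
  rewrite -[- (1 + W) *+ _]mulr_natl -[(r%:R - 1) *+ _]mulr_natl natrB //.
  have Jr : #|J|%:R + 1 <= r%:R :> R by rewrite natr1 ler_nat.
  have rIR : r%:R <= #|I|%:R :> R by rewrite ler_nat.
  have J0 : 0 <= #|J|%:R :> R by rewrite ler0n.
  move: tW Jr rIR J0; move: #|J|%:R r%:R #|I|%:R t%:R => q r' i' t'.
  move=> tW Jr rI' q0.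
  have -> : q * - (1 + W) + (t' - q) * (r' - 1)
      = (t' - q - 1 - W) * (r' - 1) + (1 + W) * (r' - 1 - q) by ring.
  by rewrite addr_ge0 // mulr_ge0 //; lra.
have [h h_inj] := block_injection tkT.
pose B j := [set h (j, i) | i : 'I_k].
have cB j : #|B j| = k by rewrite card_imset ?card_ord // => i i' /h_inj[].
have [t0|] := posnP t.
  move: Wa; rewrite ltNge (le_trans (ler_sum _ (fun i _ => aM i))) // sumr_const.
  have := tW; rewrite t0 => IW.
  have : #|I|%:R <= 0 :> R by apply: le_trans IW; rewrite lerDl.
  by rewrite lern0 => /eqP ->; rewrite mulr0n.
move=> t0; have [c c0 perm_sum] := sum_perm_imset R (B (Ordinal t0)).
rewrite -subr_ge0 -sumrB.
rewrite -(@pmulr_rge0 _ (c%:R * t%:R)) ?mulr_gt0 ?ltr0n //.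
have -> : c%:R * t%:R * (\sum_(A : {set T} | #|A| == k) f (\sum_(x in A) w x))
    = \sum_(s : {perm T}) \sum_j f (\sum_(x in s @: B j) w x).
  rewrite exchange_big /=.
  have blk j : \sum_(s : {perm T}) f (\sum_(x in s @: B j) w x)
      = c%:R * \sum_(A : {set T} | #|A| == k) f (\sum_(x in A) w x).
    by rewrite (perm_sum (B j) (fun A => f (\sum_(x in A) w x))) ?cB.
  by under [RHS]eq_bigr => j _ do rewrite blk; rewrite sumr_const card_ord mulrAC mulr_natr.
apply: sumr_ge0 => s _; apply: pointwise => [j|]; first by apply: sumr_ge0.
have -> : \sum_j \sum_(x in s @: B j) w x = \sum_p w (s (h p)).
  rewrite (eq_bigr (fun j => \sum_i w (s (h (j, i))))) => [|j _].
    by rewrite pair_bigA; apply: eq_bigr => -[].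
  rewrite big_imset /=; last by move=> ? ? _ _; apply: perm_inj.
  by rewrite big_imset //= => i i' _ _ /h_inj[].
have sh_inj : injective (fun p => s (h p)) by move=> p q /perm_inj/h_inj.
rewrite -(big_imset w (h := fun p => s (h p)) (A := predT)) => [|? ? _ _ /sh_inj //].
by rewrite [leLHS]big_mkcond; apply: ler_sum => x _; case: ifP.
Qed.

(** * Tail bounds for the weight of a random k-subset *)

Lemma one_minus_prod_le_sum (R : realDomainType) (I : finType) (P : pred I) (y : I -> R) :
  (forall i, 0 <= y i <= 1) -> 1 - \prod_(i | P i) (1 - y i) <= \sum_(i | P i) y i.
Proof.
move=> y01.
suff [] : 0 <= \prod_(i | P i) (1 - y i) <= 1 /\
    1 - \prod_(i | P i) (1 - y i) <= \sum_(i | P i) y i by [].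
elim/big_rec2: _ => [|i s p Pi [/andP[p0 p1] le_s]].
  by rewrite ler01 lexx subrr lexx.
have /andP[yi0 yi1] := y01 i; split.
  by rewrite mulr_ge0 ?mulr_ile1 ?subr_ge0 // lerBlDr lerDl.
have : 0 <= y i * (1 - p) by rewrite mulr_ge0 // subr_ge0.
by lra.
Qed.

Section Tails.

Variables (R : realFieldType) (T : finType) (w : T -> R) (k : nat).
Hypotheses (w0 : forall x, 0 <= w x) (k0 : (0 < k)%N) (kT : (k <= #|T|)%N).

Let C : R := 'C(#|T|, k)%:R.
Let m : R := k%:R * (\sum_x w x) / #|T|%:R.
Let Y (A : {set T}) := \sum_(x in A) w x.
Let count (b : R) : R := \sum_(A : {set T} | #|A| == k) (b <= Y A)%R%:R.

Let T0 : 0 < #|T|%:R :> R. Proof. by rewrite ltr0n (leq_trans k0). Qed.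

Let C_ge0 : 0 <= C. Proof. exact: ler0n. Qed.

Let m_ge0 : 0 <= m.
Proof. by rewrite divr_ge0 ?mulr_ge0 ?sumr_ge0. Qed.

Let sumC (c : R) : \sum_(A : {set T} | #|A| == k) c = C * c.
Proof. by rewrite sumr_const mulr_natl -cardsE card_draws. Qed.

Let sumY : \sum_(A : {set T} | #|A| == k) Y A = C * m.
Proof.
apply: (mulfI (lt0r_neq0 T0)); rewrite sum_draws_mem /m -/C.
by move: T0 => /lt0r_neq0 t0; field.
Qed.

Let tail_mul_le (b c e : R) (g : {set T} -> R) :
  (forall A, (b <= Y A)%R%:R * c <= g A) ->
  \sum_(A : {set T} | #|A| == k) g A <= e -> count b * c <= e.
Proof.
by move=> le_g; apply: le_trans; rewrite /count mulr_suml; apply: ler_sum.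
Qed.

Lemma tail_markov (b : R) : 0 <= b -> count b * b <= C * m.
Proof.
move=> b0; apply: (@tail_mul_le _ _ _ Y); last by rewrite sumY.
move=> A; case: (lerP b (Y A)) => bY; first by rewrite mul1r.
by rewrite mul0r sumr_ge0.
Qed.

Lemma tail_le_line (a b : R) : 0 < a -> b <= a -> count b <= C * (1 - (b - m) / a).
Proof.
move=> a0 ba; case: (lerP b m) => [bm|mb].
  apply: (@le_trans _ _ C).
    rewrite -[leRHS]mulr1 -sumC; apply: ler_sum => A _.
    by rewrite lern1 leq_b1.
  by rewrite ler_peMr // lerDl oppr_ge0 pmulr_lle0 ?invr_gt0 // subr_le0.
have b0 : 0 < b by apply: le_lt_trans mb.
rewrite -(ler_pM2r b0); apply: le_trans (tail_markov (ltW b0)) _.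
rewrite -mulrA ler_wpM2l // -subr_ge0.
have -> : (1 - (b - m) / a) * b - m = (b - m) * (1 - b / a) by field; rewrite lt0r_neq0.
by rewrite mulr_ge0 ?subr_ge0 ?(ltW mb) // ler_pdivrMr // mul1r.
Qed.

Lemma tail_chebyshev (a c u : R) : (forall x, w x <= u) -> m <= a -> 0 <= c ->
  count a * (a - m + c) ^+ 2 <= C * (u * m + c ^+ 2).
Proof.
move=> wu ma c0; apply: (@tail_mul_le _ _ _ (fun A => (Y A - m + c) ^+ 2)).
  move=> A; case: (lerP a (Y A)) => aY; last by rewrite mul0r sqr_ge0.
  have am : 0 <= a - m by rewrite subr_ge0.
  rewrite mul1r ler_sqr ?nnegrE ?lerD2r // addr_ge0 //.
  by rewrite (le_trans am) // lerD2r.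
have expand (A : {set T}) : (Y A - m + c) ^+ 2 = Y A ^+ 2 + (Y A * (2 * (c - m)) + (c - m) ^+ 2) by ring.
under eq_bigr => A _ do rewrite expand.
rewrite !big_split /= -mulr_suml sumY sumC.
have := @sum_draws_sqr R T k w u; rewrite k0 kT -/m -/C /= => /(_ isT) sqr_le.
apply: le_trans (lerD (sqr_le _) (lexx _)) _; first by move=> x; rewrite w0 wu.
by rewrite le_eqVlt; apply/orP; left; apply/eqP; ring.
Qed.

(* [(a - u) [a <= Y] <= Y - min(Y, u)], and [min(Y, u)] is bounded below by
   [u (1 - \prod_(x in A) (1 - w x / u))]. *)
Lemma tail_truncation (a u : R) (n : nat) :
  (forall x, w x <= u) -> 0 < u -> u <= a -> (0 < n)%N ->
  count a * (a - u) <= C * (m - u + u / (1 + m / u / n%:R) ^+ n).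
Proof.
move=> wu u0 ua n0.
pose z x := 1 - w x / u.
have z0 x : 0 <= z x by rewrite subr_ge0 ler_pdivrMr // mul1r.
apply: (@tail_mul_le _ _ _ (fun A => Y A - u + u * \prod_(x in A) z x)).
  move=> A; case: (lerP a (Y A)) => aY.
    by rewrite mul1r -[leLHS]addr0 lerD ?lerB // mulr_ge0 ?(ltW u0) // prodr_ge0.
  rewrite mul0r; have := @one_minus_prod_le_sum R T (fun x => x \in A) (fun x => w x / u).
  have zle : forall x, 0 <= w x / u <= 1.
    by move=> x; rewrite divr_ge0 ?(ltW u0) //= ler_pdivrMr // mul1r.
  move=> /(_ zle); rewrite -mulr_suml ler_pdivlMr // mulrBl mul1r -/(Y A).
  by rewrite /z; lra.
rewrite big_split /= -mulr_sumr sumrB sumY sumC -mulrBr [leRHS]mulrDr lerD2l [leRHS]mulrCA ler_pM2l //.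
apply: le_trans (sum_draws_prod kT z0) _; rewrite -/C ler_wpM2l //.
have kp : 0 < k%:R :> R by rewrite ltr0n.
have Wu : \sum_x w x <= #|T|%:R * u.
  by rewrite mulr_natl -sumr_const; apply: ler_sum.
have -> : (\sum_x z x) / #|T|%:R = 1 - m / u / k%:R.
  rewrite /z sumrB sumr_const -mulr_suml /m.
  by field; rewrite !lt0r_neq0.
have mu0 : 0 <= m / u by rewrite divr_ge0 // ltW.
have d0 : 0 < (1 + m / u / n%:R) ^+ n by rewrite exprn_gt0 // ltr_wpDr // divr_ge0.
rewrite -[leRHS]mul1r ler_pdivlMr //; apply: pow_one_minus_mul_le1 => //.
rewrite mu0 /= ler_pdivrMr // /m ler_pdivrMr // -mulrA ler_pM2l //.
by rewrite mulrC.
Qed.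

End Tails.

(* Replaces the monotonicity of [x + exp (- x)]. *)
Lemma add_inv_pow_homo (R : realFieldType) (n : nat) (x y : R) :
  (0 < n)%N -> 0 <= x -> x <= y ->
  x + (1 + x / n%:R) ^- n <= y + (1 + y / n%:R) ^- n.
Proof.
move=> n0 x0 xy; have np : 0 < n%:R :> R by rewrite ltr0n.
have y0 := le_trans x0 xy.
have dx : 1 <= 1 + x / n%:R by rewrite lerDl divr_ge0 // ltW.
have dy : 1 <= 1 + y / n%:R by rewrite lerDl divr_ge0 // ltW.
have dx0 := lt_le_trans ltr01 dx; have dy0 := lt_le_trans ltr01 dy.
rewrite -!exprVn; set r := (1 + x / n%:R)^-1; set q := (1 + y / n%:R)^-1.
have rI : 0 <= r <= 1 by rewrite /r invr_ge0 ltW //= invf_le1.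
have qI : 0 <= q <= 1 by rewrite /q invr_ge0 ltW //= invf_le1.
have rq : n%:R * (r - q) = r * q * (y - x).
  have nx : 0 < n%:R + x by rewrite ltr_wpDr.
  have ny : 0 < n%:R + y by rewrite ltr_wpDr.
  by rewrite /r /q; field; rewrite !lt0r_neq0.
suff : r ^+ n - q ^+ n <= n%:R * (r - q).
  have : r * q * (y - x) <= y - x.
    case/andP: rI => ? ?; case/andP: qI => ? ?.
    by rewrite ler_piMl ?subr_ge0 ?mulr_ile1.
  by rewrite rq; lra.
rewrite subrXX mulrC ler_wpM2r //.
  by rewrite subr_ge0 /r /q lef_pV2 ?posrE // lerD2l ler_pM2r ?invr_gt0.
rewrite -[X in X%:R](card_ord n) -sum1_card natr_sum.
case/andP: rI => ? ?; case/andP: qI => ? ?.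
by apply: ler_sum => i _; rewrite mulr_ile1 ?exprn_ge0 ?exprn_ile1.
Qed.

(* Nonnegative Bernstein coefficients on [[0, 21/100]]. *)
Lemma chebyshev_numeric (R : realFieldType) (v : R) : 0 <= v -> v <= 21 / 100 ->
  (v * (601 / 1000 * (1 - v)) + (3 / 2 * v) ^+ 2) * (1 - v)
  <= 199 / 500 * (399 / 1000 * (1 - v) + 3 / 2 * v) ^+ 2.
Proof.
move=> v0 v21.
have v1 : 0 <= 21 / 100 - v by lra.
set t := 21 / 100 - v in v1.
have : 0 <= t * t * t by rewrite !mulr_ge0.
have : 0 <= t * t * v by rewrite !mulr_ge0.
have : 0 <= t * v * v by rewrite !mulr_ge0.
have : 0 <= v * v * v by rewrite !mulr_ge0.
by rewrite /t !expr2; lra.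
Qed.

Lemma truncation_numeric (R : realFieldType) (a a0 b0 phi K q : R) :
  1 / 2 < a0 -> a0 < b0 -> a0 <= a -> a <= b0 -> b0 < 1 -> 0 <= phi -> phi <= 1 ->
  a0 * (601 / 1000 * a0 - (1 - a0) * (1 - phi)) <= 199 / 500 * (2 * a0 - 1) ->
  b0 * (601 / 1000 * b0 - (1 - b0) * (1 - phi)) <= 199 / 500 * (2 * b0 - 1) ->
  0 <= K -> q * (2 * a - 1) <= K * (601 / 1000 * a - (1 - a) * (1 - phi)) ->
  q * a <= 199 / 500 * K.
Proof.
move=> a02 a0b0 a0a ab0 b01 phi0 phi1.
have a2 : 0 < 2 * a - 1 by lra.
have a_gt0 : 0 < a by lra.
have ab : 0 < b0 - a0 by lra.
have [? ? ?] : [/\ 0 <= a - a0, 0 <= b0 - a & 0 <= 1601 / 1000 - phi] by split; lra.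
move=> ineq_a ineq_b K0 hq.
rewrite -(ler_pM2r a2) mulrAC.
apply: le_trans (_ : K * (601 / 1000 * a - (1 - a) * (1 - phi)) * a <= _).
  by rewrite ler_pM2r.
rewrite -mulrA [leRHS]mulrAC [leRHS]mulrC ler_wpM2l //.
rewrite -(ler_pM2l ab) -subr_ge0.
pose p z := 199 / 500 * (2 * z - 1) - z * (601 / 1000 * z - (1 - z) * (1 - phi)).
have [pa pb] : 0 <= p a0 /\ 0 <= p b0 by rewrite /p !subr_ge0.
rewrite [leRHS](_ : _ = (b0 - a) * p a0 + (a - a0) * p b0
    + (1601 / 1000 - phi) * ((a - a0) * (b0 - a) * (b0 - a0))); last by rewrite /p; field.
by rewrite !addr_ge0 // !mulr_ge0 // ltW.
Qed.

Section UpperTail.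

Variables (R : realFieldType) (T : finType) (w : T -> R) (k : nat) (a : R).
Hypotheses (w0 : forall x, 0 <= w x) (k0 : (0 < k)%N) (kT : (k <= #|T|)%N).

Let C : R := 'C(#|T|, k)%:R.
Let m : R := k%:R * (\sum_x w x) / #|T|%:R.
Let cnt : R := \sum_(A : {set T} | #|A| == k) (a <= \sum_(x in A) w x)%R%:R.

Hypotheses (wa : forall x, w x <= 1 - a) (a1 : a <= 1).
Hypothesis (ma : m <= 601 / 1000 * a).

Let C_ge0 : 0 <= C. Proof. exact: ler0n. Qed.

Let m_ge0 : 0 <= m.
Proof. by rewrite divr_ge0 ?mulr_ge0 ?sumr_ge0. Qed.

Lemma upper_tail_chebyshev : 79 / 100 <= a -> cnt * a <= 199 / 500 * C.
Proof.
have cnt0 : 0 <= cnt by apply: sumr_ge0 => A _; apply: ler0n.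
have := fun c => @tail_chebyshev R T w k w0 k0 kT a c _ wa.
rewrite -/C -/m -/cnt => cheb.
move: cnt cnt0 C C_ge0 m m_ge0 ma cheb => q q0 K K0 n n0 na cheb a79.
have u0 : 0 <= 1 - a by rewrite subr_ge0.
have u21 : 1 - a <= 21 / 100 by lra.
have c0 : 0 <= 3 / 2 * (1 - a) by lra.
have a0 : 0 <= a by lra.
have am : n <= a by lra.
have d0 : 0 < 399 / 1000 * a + 3 / 2 * (1 - a) by lra.
have dm : 399 / 1000 * a + 3 / 2 * (1 - a) <= a - n + 3 / 2 * (1 - a) by lra.
have numeric := chebyshev_numeric u0 u21.
rewrite -(@ler_pM2r _ ((399 / 1000 * a + 3 / 2 * (1 - a)) ^+ 2)) ?exprn_gt0 // mulrAC.
rewrite [1 - (1 - a)]subKr in numeric.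
apply: le_trans (_ : K * ((1 - a) * (601 / 1000 * a) + (3 / 2 * (1 - a)) ^+ 2) * a <= _).
  rewrite ler_wpM2r //.
  apply: le_trans (le_trans _ (cheb _ am c0)) _.
    by rewrite ler_wpM2l // ler_sqr ?nnegrE // ltW // (lt_le_trans d0).
  by rewrite ler_wpM2l // lerD2r ler_wpM2l.
by rewrite -mulrA [leRHS]mulrAC [leRHS]mulrC ler_wpM2l.
Qed.

Lemma upper_tail_truncation (a0 b0 c phi : R) :
  1 / 2 < a0 -> a0 < b0 -> a0 <= a -> a <= b0 -> b0 < 1 -> 0 <= phi -> phi <= 1 ->
  0 < c -> 32 * (c - 1) * (1 - a0) <= 601 / 1000 * a0 -> 1 <= phi * c ^+ 32 ->
  a0 * (601 / 1000 * a0 - (1 - a0) * (1 - phi)) <= 199 / 500 * (2 * a0 - 1) ->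
  b0 * (601 / 1000 * b0 - (1 - b0) * (1 - phi)) <= 199 / 500 * (2 * b0 - 1) ->
  cnt * a <= 199 / 500 * C.
Proof.
have := fun n => @tail_truncation R T w k w0 k0 kT a _ n wa.
rewrite -/C -/m -/cnt => hinge.
move: cnt C C_ge0 m m_ge0 ma hinge => q K K0 n n0 na hinge.
move=> a02 a0b0 a0a ab0 b01 phi0 phi1.
have u0 : 0 < 1 - a by lra.
have ua : 1 - a <= a by lra.
have uE : a - (1 - a) = 2 * a - 1 by ring.
have ua0 : 1 - a <= 1 - a0 by lra.
have ca : 601 / 1000 * a0 <= 601 / 1000 * a by lra.
have ca0 : 0 <= 601 / 1000 * a0 by lra.
have u00 : 0 < 1 - a0 by lra.
move=> c0 cx phic ineq_a ineq_b.
apply: (truncation_numeric a02 a0b0 a0a ab0 b01 phi0 phi1 ineq_a ineq_b K0).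
rewrite -uE; apply: le_trans (hinge 32 u0 ua isT) _; rewrite ler_wpM2l //.
set x := n / (1 - a); have nE : n = (1 - a) * x by rewrite /x mulrC divfK // lt0r_neq0.
set y := 601 / 1000 * a / (1 - a).
have x0 : 0 <= x by rewrite divr_ge0 // ltW.
have xy : x <= y by rewrite ler_pM2r ?invr_gt0.
have mono := add_inv_pow_homo (isT : 0 < 32)%N x0 xy.
have cy : c <= 1 + y / 32.
  rewrite -lerBlDl ler_pdivlMr // mulrC /y.
  have cx' : 32 * (c - 1) <= 601 / 1000 * a0 / (1 - a0) by rewrite ler_pdivlMr.
  apply: le_trans cx' _.
  by rewrite ler_pM ?invr_ge0 ?(ltW u00) // lef_pV2 ?posrE.
have phiy : (1 + y / 32) ^- 32 <= phi.
  rewrite -[leLHS]mul1r ler_pdivrMr ?exprn_gt0 ?(lt_le_trans c0) //.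
  apply: le_trans phic _; rewrite ler_wpM2l // lerXn2r ?nnegrE ?(ltW c0) //.
  exact: le_trans (ltW c0) cy.
have -> : n - (1 - a) + (1 - a) / (1 + x / 32) ^+ 32
    = (1 - a) * (x + (1 + x / 32) ^- 32 - 1).
  by rewrite nE; move: (_ ^- 32) => z; ring.
have -> : 601 / 1000 * a - (1 - a) * (1 - phi) = (1 - a) * (y + phi - 1).
  by rewrite /y; field; rewrite lt0r_neq0.
by rewrite ler_pM2l // lerD2r (le_trans mono) // lerD2l.
Qed.

End UpperTail.

Lemma exp32_ge (R : realFieldType) (c d1 d2 d3 d4 d5 : R) :
  0 <= c -> 0 <= d1 -> 0 <= d2 -> 0 <= d3 -> 0 <= d4 ->
  d1 <= c * c -> d2 <= d1 * d1 -> d3 <= d2 * d2 -> d4 <= d3 * d3 -> d5 <= d4 * d4 ->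
  d5 <= c ^+ 32.
Proof.
move=> c0 p1 p2 p3 p4 h1 h2 h3 h4 h5.
have sqr_le (d x : R) n : 0 <= d -> d <= x ^+ n -> d * d <= x ^+ (n + n).
  by move=> d0 dx; rewrite exprD ler_pM.
apply: le_trans h5 (sqr_le _ _ 16%N p4 _).
apply: le_trans h4 (sqr_le _ _ 8%N p3 _).
apply: le_trans h3 (sqr_le _ _ 4%N p2 _).
apply: le_trans h2 (sqr_le _ _ 2%N p1 _).
by rewrite expr2.
Qed.

Lemma upper_tail_le (R : realFieldType) (T : finType) (w : T -> R) (k : nat) (a : R) :
  (forall x, 0 <= w x <= 1 - a) -> (0 < k <= #|T|)%N -> 33 / 50 <= a <= 1 ->
  k%:R * (\sum_x w x) / #|T|%:R <= 601 / 1000 * a ->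
  (\sum_(A : {set T} | #|A| == k) (a <= \sum_(x in A) w x)%R%:R) * a
  <= 199 / 500 * 'C(#|T|, k)%:R.
Proof.
move=> w01 /andP[k0 kT] /andP[a66 a1] ma.
have w0 x : 0 <= w x by case/andP: (w01 x).
have wa x : w x <= 1 - a by case/andP: (w01 x).
have hinge := upper_tail_truncation w0 k0 kT wa ma.
case: (lerP (79 / 100) a) => [a79|/ltW a79]; first exact: upper_tail_chebyshev.
clear w01 ma w0 wa k0 kT.
have pow := @exp32_ge R.
case: (lerP a (143 / 200)) => [?|/ltW ?].
  have e : 25 / 8 <= (57 / 55) ^+ 32 :> R.
    by apply: (pow _ (189/176) (128/111) (246/185) (122/69)); lra.
  move: (_ ^+ 32) e (hinge (33/50) (143/200) (57/55) (8/25)); clear hinge pow => z e; apply; lra.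
case: (lerP a (151 / 200)) => [?|/ltW ?].
  have e : 419 / 98 <= (45 / 43) ^+ 32 :> R.
    by apply: (pow _ (311/284) (289/241) (371/258) (122/59)); lra.
  move: (_ ^+ 32) e (hinge (143/200) (151/200) (45/43) (117/500)); clear hinge pow => z e; apply; lra.
case: (lerP a (39 / 50)) => [?|/ltW ?].
  have e : 583 / 97 <= (55 / 52) ^+ 32 :> R.
    by apply: (pow _ (66/59) (234/187) (119/76) (76/31)); lra.
  move: (_ ^+ 32) e (hinge (151/200) (39/50) (55/52) (333/2000)); clear hinge pow => z e; apply; lra.
have e : 631 / 82 <= (97 / 91) ^+ 32 :> R.
  by apply: (pow _ (317/279) (71/55) (498/299) (663/239)); lra.
move: (_ ^+ 32) e (hinge (39/50) (79/100) (97/91) (13/100)); clear hinge pow => z e; apply; lra.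
Qed.

(** * The inequality between tail probabilities *)

Section Core.

Variables (R : realFieldType) (T I : finType) (w : T -> R) (a : I -> R) (amax : R) (k s : nat).
Let W := \sum_x w x.
Hypotheses (w01 : forall x, 0 <= w x <= 1 - amax) (amax1 : amax <= 1).
Hypotheses (a_le : forall i, a i <= amax) (Wa : W < \sum_i a i).
Hypotheses (cI : #|I| = s.+1) (s2000 : (2000 <= s)%N) (k0 : (0 < k)%N).
Hypothesis kT : (5 * s * k <= 3 * (#|T| + 1))%N.

Let w0 x : 0 <= w x. Proof. by case/andP: (w01 x). Qed.

Let W0 : 0 <= W. Proof. exact: sumr_ge0. Qed.

(* With [m] the mean weight, Markov's inequality makes [P(Y >= a i)] at most [1 - (a i - m) / amax],
   which is linear in [a i]. *)
Lemma tails_ge_of_concentration : (3 * W >= 2 * s%:R - 6) ->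
  \sum_(A : {set T} | #|A| == k) (1 + W * (amax <= \sum_(x in A) w x)%R%:R)
  <= \sum_(A : {set T} | #|A| == k) \sum_i (\sum_(x in A) w x < a i)%R%:R.
Proof.
move=> Ws.
have kT' : (k <= #|T|)%N by nia.
set C : R := 'C(#|T|, k)%:R; have C0 : 0 <= C by apply: ler0n.
have sR : 2000 <= s%:R :> R by rewrite ler_nat.
set m := k%:R * W / #|T|%:R.
have kR : 0 < k%:R :> R by rewrite ltr0n.
have M0 : 0 < #|T|%:R :> R by rewrite ltr0n (leq_trans k0).
have sumA : \sum_i a i <= (s%:R + 1) * amax.
  apply: le_trans (ler_sum _ (fun i _ => a_le i)) _.
  by rewrite sumr_const cI natr1 mulr_natl.
have amaxW : W < (s%:R + 1) * amax by apply: lt_le_trans Wa sumA.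
have amax0 : 33 / 50 <= amax.
  rewrite leNgt; apply/negP => small; move: amaxW; apply/negP; rewrite -leNgt.
  apply: le_trans (_ : (s%:R + 1) * (33 / 50) <= _); last by lra.
  by rewrite ler_wpM2l ?(ltW small) // addr_ge0.
have Dk : k%:R * (s%:R + 1) <= 601 / 1000 * #|T|%:R :> R.
  have : (k * (5 * s) <= 3 * #|T| + 3 * k)%N.
    by rewrite mulnC (leq_trans kT) // mulnDr leq_add2l leq_mul2l.
  rewrite -(ler_nat R) natrD !natrM => kTR.
  have : 0 <= k%:R * (s%:R - 2000) :> R by rewrite mulr_ge0 ?subr_ge0 // ltW.
  by lra.
have Dm : (s%:R + 1) * m <= 601 / 1000 * W.
  have -> : (s%:R + 1) * m = W * (k%:R * (s%:R + 1) / #|T|%:R) by rewrite /m; ring.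
  by rewrite [leRHS]mulrC ler_wpM2l // ler_pdivrMr.
have ma : m <= 601 / 1000 * amax.
  have D0 : 0 < s%:R + 1 :> R by lra.
  rewrite -(ler_pM2l D0); apply: le_trans Dm _; rewrite mulrCA ler_pM2l //; last by lra.
  exact: ltW.
have tail : (\sum_(A : {set T} | #|A| == k) (amax <= \sum_(x in A) w x)%R%:R) * amax
    <= 199 / 500 * C.
  by apply: upper_tail_le; rewrite ?k0 ?amax0.
have amax_gt0 : 0 < amax by lra.
have sum1 : \sum_(A : {set T} | #|A| == k) 1 = C.
  by rewrite /C -card_draws -sum1dep_card natr_sum.
rewrite [leRHS]exchange_big /= big_split /= -mulr_sumr sum1.
set cnt := \sum_(A | _) _ in tail *.
have line i : C * ((a i - m) / amax)
    <= \sum_(A : {set T} | #|A| == k) (\sum_(x in A) w x < a i)%R%:R.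
  have := tail_le_line w0 k0 kT' amax_gt0 (a_le i); rewrite -/W -/m -/C => le_cnt.
  have -> : \sum_(A : {set T} | #|A| == k) (\sum_(x in A) w x < a i)%R%:R
      = C - \sum_(A : {set T} | #|A| == k) (a i <= \sum_(x in A) w x)%R%:R :> R.
    rewrite -sum1 -sumrB; apply: eq_bigr => A _.
    by rewrite leNgt; case: (_ < _); rewrite ?subr0 ?subrr.
  by move: le_cnt; rewrite mulrBr mulr1; lra.
apply: le_trans (ler_sum _ (fun i _ => line i)).
rewrite -mulr_sumr -mulr_suml sumrB sumr_const cI -[m *+ _]mulr_natl -natr1.
rewrite mulrA ler_pdivlMr // mulrDl -[W * _ * _]mulrA.
have Wtail := ler_wpM2l W0 tail.
apply: le_trans (_ : C * 1 + W * (199 / 500 * C) <= _).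
  by rewrite lerD // ler_wpM2l.
have -> : C * 1 + W * (199 / 500 * C) = C * (1 + 199 / 500 * W) by ring.
rewrite ler_wpM2l // (le_trans _ (lerB (ltW Wa) Dm)) //.
have W1000 : 1000 <= W by lra.
by lra.
Qed.

Lemma tails_ge :
  \sum_(A : {set T} | #|A| == k) (1 + W * (amax <= \sum_(x in A) w x)%R%:R)
  <= \sum_(A : {set T} | #|A| == k) \sum_i (\sum_(x in A) w x < a i)%R%:R.
Proof.
set t := (#|T| %/ k)%N.
case: (lerP (#|I|%:R + W) t%:R) => [tW|tW].
  by apply: (tails_ge_of_disjoint_sets w0 a_le Wa k0 _ tW); apply: leq_divM.
apply: tails_ge_of_concentration.
have : (5 * s <= 3 * (t + 1))%N.
  rewrite -(leq_pmul2r k0) (leq_trans kT) // -mulnA leq_mul2l /=.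
  by rewrite !addn1 -ltn_divLR.
move: tW; rewrite cI -natr1 -(ler_nat R) natrM [(3 * _)%:R]natrM natrD.
by move: s%:R t%:R => x y; lra.
Qed.

End Core.

(** * Linear programming duality *)

Lemma exists_between (R : realDomainType) (T : eqType) (A B : seq T) (f : T -> R) :
  (forall p q, p \in A -> q \in B -> f p <= f q) ->
  exists c, (forall p, p \in A -> f p <= c) /\ (forall q, q \in B -> c <= f q).
Proof.
elim: A => [|p A IHA] AB.
  elim: B {AB} => [|q B [c [_ cB]]]; first by exists 0.
  exists (Num.min c (f q)); split=> // q'.
  by rewrite inE ge_min => /predU1P[->|/cB->//]; rewrite lexx orbT.
have [|c [cA cB]] := IHA; first by move=> p' q p'A qB; apply: AB; rewrite // inE p'A orbT.
exists (Num.max c (f p)); split=> [p'|q qB].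
  by rewrite inE le_max => /predU1P[->|/cA->//]; rewrite lexx orbT.
by rewrite ge_max cB // AB // inE eqxx.
Qed.

Section Farkas.

Variables (R : realFieldType) (T : finType).

Let constraint := ({ffun T -> R} * R)%type.

Definition satisfies (v : T -> R) (p : constraint) := p.2 <= \sum_x p.1 x * v x.

Definition cone_closed (P : constraint -> Prop) : Prop :=
  (forall p q, P p -> P q -> P ([ffun x => p.1 x + q.1 x], p.2 + q.2)) /\
  (forall c p, 0 <= c -> P p -> P ([ffun x => c * p.1 x], c * p.2)).

(* Fourier-Motzkin elimination of the variables in [X]. *)
Lemma farkas_eliminate (X : seq T) (S : seq constraint) :
  (forall p x, p \in S -> x \notin X -> p.1 x = 0) ->
  (exists v, forall p, p \in S -> satisfies v p) \/
  (forall P, cone_closed P -> (forall p, p \in S -> P p) ->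
   exists2 p, P p & (forall x, p.1 x = 0) /\ 0 < p.2).
Proof.
elim: X S => [|z X IH] S suppS.
  case: (boolP (all (fun p : constraint => p.2 <= 0) S)) => [/allP neg|].
    left; exists (fun=> 0) => p pS; rewrite /satisfies big1 ?neg // => x _.
    by rewrite mulr0.
  rewrite -has_predC => /hasP[p pS /=]; rewrite -ltNge => p0.
  by right=> P _ PS; exists p; [apply: PS|split=> // x; apply: suppS].
pose comb (p q : constraint) : constraint :=
  ([ffun x => - q.1 z * p.1 x + p.1 z * q.1 x], - q.1 z * p.2 + p.1 z * q.2).
pose S0 := [seq p : constraint <- S | p.1 z == 0].
pose Sp := [seq p : constraint <- S | 0 < p.1 z].
pose Sn := [seq p : constraint <- S | p.1 z < 0].
have inS0 p : (p \in S0) = (p.1 z == 0) && (p \in S) by rewrite mem_filter.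
have inSp p : (p \in Sp) = (0 < p.1 z) && (p \in S) by rewrite mem_filter.
have inSn p : (p \in Sn) = (p.1 z < 0) && (p \in S) by rewrite mem_filter.
have [|[v satv]|cone] := IH (S0 ++ [seq comb p q | p <- Sp, q <- Sn]).
- move=> p x; rewrite mem_cat => /orP[+ xX|/allpairsP[[p' q'] /= [p'S q'S ->]] xX].
    rewrite inS0 => /andP[/eqP pz pS].
    by have [->//|xz] := eqVneq x z; apply: suppS; rewrite // inE (negbTE xz).
  move: p'S q'S; rewrite inSp inSn => /andP[_ p'S] /andP[_ q'S]; rewrite ffunE.
  have [->|xz] := eqVneq x z; first by ring.
  by rewrite !(suppS _ x) ?mulr0 ?addr0 // inE negb_or xz.
- left; pose rest (p : constraint) := \sum_(x | x != z) p.1 x * v x.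
  pose bound (p : constraint) := (p.2 - rest p) / p.1 z.
  have le_bound p q : p \in Sp -> q \in Sn -> bound p <= bound q.
    move=> pS qS; have := satv (comb p q); rewrite mem_cat allpairs_f ?orbT // => /(_ isT).
    move: pS qS; rewrite inSp inSn => /andP[pz _] /andP[qz _].
    rewrite /satisfies.
    have -> : \sum_x (comb p q).1 x * v x = - q.1 z * rest p + p.1 z * rest q.
      rewrite !mulr_sumr -big_split (bigD1 z) //= ffunE.
      rewrite [X in X * v z](_ : _ = 0) ?mul0r ?add0r; last by ring.
      by apply: eq_bigr => x _; rewrite ffunE mulrDl !mulrA.
    move=> le_comb; rewrite /bound ler_pdivrMr // mulrAC ler_ndivlMr //.
    by move: le_comb => /=; lra.
  have [c [cp cn]] : exists c, (forall p, p \in Sp -> bound p <= c) /\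
      (forall q, q \in Sn -> c <= bound q) by apply: exists_between.
  exists (fun x => if x == z then c else v x) => p pS.
  rewrite /satisfies (bigD1 z) //= eqxx.
  have -> : \sum_(x | x != z) p.1 x * (if x == z then c else v x) = rest p.
    by apply: eq_bigr => x /negbTE->.
  have [pz|pz|pz] := ltrgt0P (p.1 z).
  + have := cp p; rewrite inSp pz pS => /(_ isT).
    by rewrite /bound ler_pdivrMr // lerBlDr mulrC.
  + have := cn p; rewrite inSn pz pS => /(_ isT).
    by rewrite /bound ler_ndivlMr // lerBlDr mulrC.
  + have := satv p; rewrite mem_cat inS0 pz eqxx pS => /(_ isT).
    by rewrite /satisfies (bigD1 z) //= pz !mul0r.
- right=> P [PD PM] PS; apply: cone; first by split.
  move=> p; rewrite mem_cat => /orP[|/allpairsP[[p' q'] /= [+ + ->]]].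
    by rewrite inS0 => /andP[_]; apply: PS.
  rewrite inSp inSn => /andP[p'z p'S] /andP[q'z q'S].
  have := PD _ _ (PM (- q'.1 z) _ _ (PS _ p'S)) (PM (p'.1 z) _ _ (PS _ q'S)).
  rewrite oppr_ge0 !ltW // => /(_ isT isT); congr P.
  by rewrite /comb /=; congr (_, _); apply/ffunP => x; rewrite !ffunE.
Qed.

Lemma farkas (S : seq constraint) :
  (exists v, forall p, p \in S -> satisfies v p) \/
  (forall P, cone_closed P -> (forall p, p \in S -> P p) ->
   exists2 p, P p & (forall x, p.1 x = 0) /\ 0 < p.2).
Proof. by apply: (@farkas_eliminate (enum T)) => p x _; rewrite mem_enum. Qed.

End Farkas.

Lemma fractional_cover (R : realType) (n : nat) (F : {set {set 'I_n}}) :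
  set0 \notin F ->
  exists v : 'I_n -> R, [/\ forall x, 0 <= v x,
    forall A, A \in F -> 1 <= \sum_(x in A) v x & \sum_x v x <= nu_star R F].
Proof.
move=> F0; set c := nu_star R F.
have size_le (w : {set 'I_n} -> R) : fractional_matching F w -> weight_size F w <= c.
  move=> fw; apply: ub_le_sup; last by exists w.
  exists (\sum_(A in F) 1) => _ [w' [w'01 _] <-].
  by apply: ler_sum => A /w'01/andP[].
pose ind (A : {set 'I_n}) : {ffun 'I_n -> R} * R := ([ffun x => (x \in A)%:R], 1).
pose pos (x : 'I_n) : {ffun 'I_n -> R} * R := ([ffun y => (y == x)%:R], 0).
pose tot : {ffun 'I_n -> R} * R := ([ffun=> -1], - c).
have [[v satv]|cone] := farkas (tot :: [seq ind A | A <- enum F] ++ [seq pos x | x <- enum 'I_n]).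
  exists v; split.
  - move=> x; have := satv (pos x); rewrite inE mem_cat map_f ?mem_enum // !orbT => /(_ isT).
    rewrite /satisfies /= (bigD1 x) //= ffunE eqxx mul1r big1 ?addr0 // => y yx.
    by rewrite ffunE (negbTE yx) mul0r.
  - move=> A AF; have := satv (ind A).
    rewrite inE mem_cat map_f ?mem_enum // !orbT => /(_ isT).
    rewrite /satisfies /= => /le_trans; apply; rewrite [leRHS]big_mkcond /=.
    apply: ler_sum => x _; rewrite ffunE [_ \in _]unfold_in.
    by case: ifP; rewrite ?mul1r ?mul0r.
  - have := satv tot; rewrite inE eqxx => /(_ isT); rewrite /satisfies /=.
    by under eq_bigr => x _ do rewrite ffunE mulN1r; rewrite sumrN lerN2.
pose P (p : {ffun 'I_n -> R} * R) := exists (y : {set 'I_n} -> R) (y0 : R),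
  [/\ forall A, 0 <= y A, 0 <= y0, forall x, \sum_(A in F | x \in A) y A - y0 <= p.1 x
    & p.2 <= \sum_(A in F) y A - c * y0].
have [||[a b] [y [y0 [ypos y0pos ya yb]]] /= [a0 b0]] := cone P.
- split=> [p q [y [y0 [h1 h2 h3 h4]]] [y' [y0' [h1' h2' h3' h4']]]|d p d0 [y [y0 [h1 h2 h3 h4]]]].
    exists (fun A => y A + y' A), (y0 + y0'); split=> [A||x|].
    + by rewrite addr_ge0.
    + by rewrite addr_ge0.
    + by rewrite big_split /= ffunE opprD addrACA lerD.
    + by rewrite big_split /= mulrDr opprD addrACA lerD.
  exists (fun A => d * y A), (d * y0); split=> [A||x|].
  + by rewrite mulr_ge0.
  + by rewrite mulr_ge0.
  + by rewrite -mulr_sumr ffunE -mulrBr ler_wpM2l.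
  + by rewrite -mulr_sumr mulrCA -mulrBr ler_wpM2l.
- move=> p; rewrite inE mem_cat => /or3P[/eqP->|/mapP[A + ->]|/mapP[x _ ->]].
  + exists (fun=> 0), 1; split=> // [x|]; first by rewrite big1 // ffunE add0r.
    by rewrite big1 //= mulr1 add0r.
  + rewrite mem_enum => AF; exists (fun B => (B == A)%:R), 0; split=> // [x|].
    * rewrite subr0 ffunE; case: (boolP (x \in A)) => xA.
        rewrite (bigD1 A) ?AF //= eqxx big1 ?addr0 // => B /andP[_ /negbTE->] //.
      by rewrite big1 // => B /andP[_ xB]; case: eqP xB xA => // -> ->.
    * rewrite mulr0 subr0 (bigD1 A) //= eqxx big1 ?addr0 // => B /andP[_ /negbTE->] //.
  + exists (fun=> 0), 0; split=> // [y|]; first by rewrite big1 // ffunE subr0 ler0n.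
    by rewrite big1 //= mulr0 subr0.
have yx x : \sum_(A in F | x \in A) y A <= y0 by have := ya x; rewrite /= a0 subr_le0.
have y_le A : A \in F -> y A <= y0.
  move=> AF; have /set0Pn[x xA] : A != set0 by apply: contraNneq F0 => <-.
  apply: le_trans (yx x); rewrite (bigD1 A) ?AF //= lerDl; exact: sumr_ge0.
have [y00|y0n] := eqVneq y0 0.
  have := lt_le_trans b0 yb; rewrite y00 mulr0 subr0 big1 ?ltxx // => A AF.
  by apply/eqP; rewrite eq_le ypos -y00 y_le.
have y0p : 0 < y0 by rewrite lt_def y0n.
have fm : fractional_matching F (fun A => y A / y0).
  split=> [A AF|x]; first by rewrite divr_ge0 //= ler_pdivrMr // mul1r y_le.
  by rewrite -mulr_suml ler_pdivrMr // mul1r.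
have := size_le _ fm; rewrite /weight_size -mulr_suml ler_pdivrMr //.
by rewrite leNgt -subr_gt0 (lt_le_trans b0 yb).
Qed.

(** * Light sets *)

Lemma exists_top_set (R : realDomainType) (V : finType) (w : V -> R) (j : nat) :
  (j <= #|V|)%N ->
  exists2 S : {set V}, #|S| = j & forall x y, x \in S -> y \notin S -> w y <= w x.
Proof.
elim: j => [_|j IH jV]; first by exists set0; rewrite ?cards0 // => x y; rewrite inE.
have [S cS topS] := IH (ltnW jV).
have /set0Pn[z0 z0S] : ~: S != set0.
  by rewrite -card_gt0 cardsCs setCK cS subn_gt0.
have [z zS maxz] : exists2 z, z \in ~: S & forall y, y \in ~: S -> w y <= w z.
  by case: (arg_maxP w z0S) => z ? ?; exists z.
exists (z |: S); first by rewrite cardsU1 cS; move: zS; rewrite inE => ->.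
move=> x y; rewrite !inE negb_or => /predU1P[->|xS] /andP[_ yS].
  by apply: maxz; rewrite inE.
exact: topS.
Qed.

Lemma heavy_sets_le (R : realFieldType) (T : finType) (w : T -> R) (b : R) (k : nat) :
  (forall x, 0 <= w x <= 1 - b) ->
  #|[set B : {set T} | (#|B| == k.+1) && (1 <= \sum_(x in B) w x)%R]|%:R
  <= (\sum_x w x) * \sum_(A : {set T} | #|A| == k) (b <= \sum_(x in A) w x)%R%:R.
Proof.
move=> w01; have w0 x : 0 <= w x by case/andP: (w01 x).
rewrite -sum1dep_card natr_sum big_mkcondr /=.
pose heavy (B : {set T}) : R := (1 <= \sum_(x in B) w x)%R%:R.
apply: (@le_trans _ _ (\sum_(B : {set T} | #|B| == k.+1) \sum_(x in B) heavy B * w x)).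
  apply: ler_sum => B _; rewrite -mulr_sumr /heavy.
  by case: ifP => [|_]; rewrite ?mul1r ?mul0r.
rewrite (exchange_big_dep xpredT) //= mulr_suml; apply: ler_sum => x _.
rewrite -mulr_suml mulrC ler_wpM2l //.
rewrite (reindex_onto (fun A => x |: A) (fun B => B :\ x)) /=; last first.
  by move=> B /andP[_ xB]; rewrite setD1K.
rewrite [leRHS]big_mkcond [leLHS]big_mkcond; apply: ler_sum => A _.
case: ifP => [/andP[/andP[cA _] /eqP xA]|_]; last by case: ifP => _; rewrite ?ler0n.
have xnA : x \notin A by rewrite -xA !inE eqxx.
move: cA; rewrite cardsU1 xnA add1n eqSS => ->.
rewrite /heavy big_setU1 //= ler_nat; case: (lerP 1 _) => //= le1.
suff -> : b <= \sum_(y in A) w y by [].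
by have /andP[_] := w01 x; lra.
Qed.

Lemma light_singletons (R : realFieldType) (V : finType) (w : V -> R) (s : nat) :
  (forall x, 0 <= w x) -> \sum_x w x < s%:R + 1 ->
  ('C(#|V| - s, 1) <= #|[set A : {set V} | (#|A| == 1) && (\sum_(x in A) w x < 1)%R]|)%N.
Proof.
move=> w0 sumw; rewrite bin1.
have heavy : (#|[set x | (1 <= w x)%R]| <= s)%N.
  rewrite -ltnS -(ltr_nat R) -natr1; apply: le_lt_trans sumw.
  rewrite -sum1dep_card natr_sum big_mkcond /=; apply: ler_sum => x _.
  by case: ifP.
apply: leq_trans (leq_sub2l _ heavy) _.
have -> : [set x | (1 <= w x)%R] = ~: [set x | (w x < 1)%R].
  by apply/setP => x; rewrite !inE leNgt.
rewrite -cardsCs -(card_imset _ set1_inj); apply: subset_leq_card.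
apply/subsetP => _ /imsetP[x + ->]; rewrite !inE => wx1.
by rewrite cards1 eqxx big_set1.
Qed.

Section LightSets.

Variables (R : realFieldType) (V : finType) (w : V -> R) (k s : nat) (Top : {set V}).
Hypothesis w0 : forall x, 0 <= w x.
Hypothesis cTop : #|Top| = s.+1.

Let T := {x in ~: Top}.
Let I := {x in Top}.
Let wT (x : T) := w (val x).
Let Y (B : {set T}) := \sum_(x in B) wT x.
Let light := [set A : {set V} | (#|A| == k.+1) && (\sum_(x in A) w x < 1)%R].

Let imT (B : {set T}) : {set V} := val @: B.

Let imT_notin (B : {set T}) (x : V) : x \in Top -> x \notin imT B.
Proof. by move=> xTop; apply/imsetP => -[y _ eqx]; have := valP y; rewrite -eqx inE xTop. Qed.

Let w_imT (B : {set T}) : \sum_(x in imT B) w x = Y B.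
Proof. by rewrite big_imset //= => x y _ _; apply: val_inj. Qed.

Let c_imT (B : {set T}) : #|imT B| = #|B|.
Proof. by rewrite card_imset //; apply: val_inj. Qed.

Let imT_inj : injective imT.
Proof. exact: imset_inj val_inj. Qed.

Lemma light_sets_ge :
  (#|[set p : {set T} * I | (#|p.1| == k) && (Y p.1 < 1 - w (val p.2))%R]|
   + #|[set B : {set T} | (#|B| == k.+1) && (Y B < 1)%R]| <= #|light|)%N.
Proof.
set X1 := [set p | _]; set X2 := [set B | _].
pose f (p : {set T} * I) := val p.2 |: imT p.1.
have f_inj : injective f.
  move=> [B i] [B' i'] eqf.
  have eqi : i = i'.
    apply: val_inj; have : val i \in f (B', i') by rewrite -eqf setU11.
    by rewrite !inE => /predU1P[//|]; rewrite (negbTE (imT_notin _ (valP i))).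
  subst i'; congr (_, _); apply: imT_inj.
  have restr C : imT C = f (C, i) :\ val i by rewrite setU1K // imT_notin // (valP i).
  by rewrite (restr B) (restr B') eqf.
rewrite -(card_imset X1 f_inj) -(card_imset X2 imT_inj) -cardsUI.
rewrite [X in (_ + X)%N](_ : _ = 0) ?addn0; last first.
  apply/eqP; rewrite cards_eq0; apply/eqP/setP => A; rewrite !inE.
  apply/negP => /andP[/imsetP[[B i] _ ->] /imsetP[B' _ eqB]].
  have : val i \in imT B' by rewrite -eqB setU11.
  by rewrite (negbTE (imT_notin _ (valP i))).
apply: subset_leq_card; apply/subsetP => A; rewrite inE => /orP[] /imsetP.
  case=> [[B i]]; rewrite !inE /= => /andP[/eqP cB lt1] ->.
  rewrite cardsU1 big_setU1 ?imT_notin ?(valP i) //= c_imT cB eqxx /= w_imT.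
  by rewrite -ltrBrDl.
by case=> B; rewrite !inE => lt1 ->; rewrite c_imT w_imT.
Qed.

Lemma light_sets_of_top :
  (2000 <= s)%N -> (0 < k)%N -> (5 * k.+1 * s <= 3 * #|V| + 2 * s)%N ->
  \sum_x w x < s%:R + 1 -> (forall x y, x \in Top -> y \notin Top -> w y <= w x) ->
  ('C(#|V| - s, k.+1) <= #|light|)%N.
Proof.
move=> s2000 k0 sV sumw top; apply: leq_trans light_sets_ge.
have cI : #|{: I}| = s.+1 by rewrite card_sig -cTop; apply: eq_card => x; rewrite !inE.
have cT : (#|{: T}| + s.+1 = #|V|)%N.
  rewrite card_sig -cTop addnC -[RHS](cardsC Top); congr (_ + _)%N.
have I0 : (0 < #|{: I}|)%N by rewrite cI.
have /card_gt0P[i00 _] := I0.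
have [i0 mini0] : exists i0 : I, forall i : I, w (val i0) <= w (val i).
  case: (@arg_minP _ _ _ i00 xpredT (fun i : I => w (val i))) => // i0 _ mini0.
  by exists i0 => i; apply: mini0.
set b := 1 - w (val i0).
have wT01 x : 0 <= wT x <= 1 - b.
  by rewrite /b subKr w0 top ?(valP i0) // -in_setC (valP x).
have sumsplit : \sum_(x : T) wT x + \sum_(i : I) w (val i) = \sum_x w x.
  rewrite -(big_sub (mem Top)) -(big_sub (mem (~: Top))) addrC [RHS](bigID (mem Top)).
  by congr (_ + _); apply: eq_bigl => x; rewrite !inE.
have Wa : \sum_(x : T) wT x < \sum_(i : I) (1 - w (val i)).
  by rewrite sumrB sumr_const cI ltrBrDr sumsplit -natr1.
have b1 : b <= 1 by rewrite /b lerBlDr lerDl.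
have ab (i : I) : 1 - w (val i) <= b by rewrite lerD2l lerN2 mini0.
have kT : (5 * s * k <= 3 * (#|{: T}| + 1))%N by move: sV; rewrite -cT; nia.
have := tails_ge wT01 b1 ab Wa cI s2000 k0 kT.
have := heavy_sets_le k wT01.
set W := \sum_x wT x.
set cnt := \sum_(A : {set T} | #|A| == k) (b <= \sum_(x in A) wT x)%R%:R.
set heavy := [set B | _]; set X1 := [set p | _]; set X2 := [set B | _].
rewrite big_split /= -mulr_sumr -/cnt => shadow.
have -> : \sum_(A : {set T} | #|A| == k) \sum_(i : I) (Y A < 1 - w (val i))%R%:R = #|X1|%:R :> R.
  rewrite /X1 -sum1dep_card natr_sum.
  rewrite [RHS]big_mkcondr /= pair_big_dep /=.
  by apply: eq_big => [p|p _]; rewrite ?andbT //; case: ifP.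
have -> : \sum_(A : {set T} | #|A| == k) 1 = 'C(#|{: T}|, k)%:R :> R.
  by rewrite -card_draws -sum1dep_card natr_sum.
move=> core_le; rewrite -(ler_nat R) natrD.
have -> : (#|V| - s = #|{: T}|.+1)%N by rewrite -cT addnS subSn ?addnK ?leq_addl.
have X2E : (#|X2| + #|heavy| = 'C(#|{: T}|, k.+1))%N.
  rewrite -card_draws -[RHS](cardsID [set B : {set T} | (Y B < 1)%R]); congr (_ + _)%N;
    by apply: eq_card => B; rewrite !inE -?leNgt // andbC.
rewrite binS natrD -X2E natrD.
by lra.
Qed.

End LightSets.

Lemma light_sets (R : realFieldType) (V : finType) (w : V -> R) (l s : nat) :
  (2000 <= s)%N -> (0 < l)%N -> (5 * l * s <= 3 * #|V| + 2 * s)%N -> (s < #|V|)%N ->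
  (forall x, 0 <= w x) -> \sum_x w x < s%:R + 1 ->
  ('C(#|V| - s, l) <= #|[set A : {set V} | (#|A| == l) && (\sum_(x in A) w x < 1)%R]|)%N.
Proof.
case: l => [//|[|k]] s2000 _ sV sV' w0 sumw; first exact: light_singletons.
have [Top cTop top] := exists_top_set w sV'.
exact: light_sets_of_top cTop _ _ _ _ top.
Qed.

(** * Reduction of degrees to light sets *)

Section DegreeBound.

Variables (R : realFieldType) (n k d s : nat) (v : 'I_n -> R) (S : {set 'I_n}).
Hypotheses (v0 : forall x, 0 <= v x) (sumv : \sum_x v x < s%:R + 1).
Hypotheses (d0 : (0 < d)%N) (dk : (d < k)%N) (kn : (k * s.+1 <= n)%N) (cS : #|S| = d).
Hypothesis low : forall x y, x \in S -> y \notin S -> v x <= v y.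
Hypothesis ln : (5 * (k - d) * s <= 3 * (n - d) + 2 * s)%N.
Hypothesis s2000 : (2000 <= s)%N.

Let V := {x in ~: S}.
Let b := (\sum_(x in S) v x) / d%:R.
Let w (x : V) := (v (val x) - b) / (1 - k%:R * b).

Let dR : 0 < d%:R :> R. Proof. by rewrite ltr0n. Qed.

Let b_ge0 : 0 <= b. Proof. by rewrite divr_ge0 ?sumr_ge0. Qed.

Let sumS : \sum_(x in S) v x = d%:R * b.
Proof. by rewrite mulrC divfK // lt0r_neq0. Qed.

Let cV : #|{: V}| = (n - d)%N.
Proof. by rewrite card_sig (@eq_card _ _ (~: S)) // cardsCs setCK card_ord cS. Qed.

Let b_le (x : V) : b <= v (val x).
Proof.
rewrite ler_pdivrMr // mulr_natr -cS -sumr_const; apply: ler_sum => y yS.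
by apply: low => //; rewrite -in_setC (valP x).
Qed.

Let sumV : \sum_(x : V) v (val x) = \sum_x v x - d%:R * b.
Proof.
rewrite -sumS [\sum_x v x](bigID (mem S)) /= [X in X - _]addrC addrK -(big_sub (mem (~: S))).
by apply: eq_bigl => x; rewrite !inE.
Qed.

Let nb : n%:R * b <= \sum_x v x.
Proof.
have : \sum_(x : V) b <= \sum_(x : V) v (val x) by apply: ler_sum => x _; apply: b_le.
rewrite sumr_const cV sumV -[b *+ _]mulr_natl lerBrDr -mulrDl -natrD subnK //.
by apply: leq_trans (leq_trans (ltnW dk) (leq_pmulr _ _)) kn.
Qed.

Let kb : k%:R * (s%:R + 1) * b <= n%:R * b.
Proof. by rewrite ler_wpM2r // natr1 -natrM ler_nat. Qed.

Let scale_gt0 : 0 < 1 - k%:R * b.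
Proof.
rewrite subr_gt0 ltNge; apply/negP => kb1.
have := le_lt_trans (le_trans kb nb) sumv; rewrite mulrAC -[ltRHS]mul1r.
by rewrite ltNge ler_wpM2r // addr_ge0.
Qed.

Lemma degree_le (F : {set {set 'I_n}}) :
  (forall A, A \in F -> #|A| = k) -> (forall A, A \in F -> 1 <= \sum_(x in A) v x) ->
  (degree F S <= 'C(n - d, k - d) - 'C(n - d - s, k - d))%N.
Proof.
move=> unif cover.
have w0 x : 0 <= w x by apply: divr_ge0; rewrite ?(ltW scale_gt0) // subr_ge0 b_le.
have sumw : \sum_x w x < s%:R + 1.
  rewrite -mulr_suml sumrB sumV sumr_const cV ltr_pdivrMr //.
  rewrite -[b *+ _]mulr_natl natrB; last first.
    by apply: leq_trans (leq_trans (ltnW dk) (leq_pmulr _ _)) kn.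
  by have := kb; have := sumv; lra.
have lV : (5 * (k - d) * s <= 3 * #|{: V}| + 2 * s)%N by rewrite cV.
have sV : (s < #|{: V}|)%N by rewrite cV; nia.
have := light_sets s2000 _ lV sV w0 sumw; rewrite subn_gt0 => /(_ dk).
set light := [set A | _]; rewrite cV => light_ge.
pose heavy := [set A : {set V} | (#|A| == k - d)%N && (1 <= \sum_(x in A) w x)%R].
have heavyE : (#|light| + #|heavy| = 'C(n - d, k - d))%N.
  rewrite -cV -card_draws -[RHS](cardsID [set A : {set V} | (\sum_(x in A) w x < 1)%R]).
  by congr (_ + _)%N; apply: eq_card => A; rewrite !inE -?leNgt // andbC.
apply: leq_trans (_ : #|heavy| <= _)%N; last by rewrite -heavyE -[leqLHS](addKn #|light|) leq_sub2l.
pose r (A : {set 'I_n}) : {set V} := val @^-1: A.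
have rD (A : {set 'I_n}) : A :\: S = val @: r A.
  apply/setP => x; rewrite inE; apply/andP/imsetP => [[xS xA]|[y]].
    have xV : x \in ~: S by rewrite inE.
    by exists (Sub x xV); rewrite ?inE ?SubK.
  by rewrite inE => yA ->; rewrite -in_setC (valP y).
rewrite /degree -(card_in_imset (f := r)); last first.
  move=> A B; rewrite !inE => /andP[_ SA] /andP[_ SB] eqr.
  by rewrite -(setID A S) -(setID B S) !rD eqr (setIidPr SA) (setIidPr SB).
apply: subset_leq_card; apply/subsetP => _ /imsetP[A + ->].
rewrite !inE => /andP[AF SA].
have cA := unif A AF; have vA := cover A AF.
have cr : #|r A| = (k - d)%N.
  by rewrite -(card_imset (r A) val_inj) -rD cardsDS // cA cS.
rewrite cr eqxx /= -mulr_suml ler_pdivlMr // mul1r sumrB sumr_const cr.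
have vsplit : \sum_(x in A) v x = d%:R * b + \sum_(x in r A) v (val x).
  rewrite (big_setID S) /= (setIidPr SA) sumS rD; congr (_ + _).
  by rewrite big_imset //= => x y _ _; apply: val_inj.
rewrite -[b *+ _]mulr_natl natrB ?(ltnW dk) //.
by move: vA; rewrite vsplit; lra.
Qed.

End DegreeBound.

Lemma big_minn_le (I : eqType) (r : seq I) (P : pred I) (F : I -> nat) (x0 : nat) (j : I) :
  j \in r -> P j -> (\big[minn/x0]_(i <- r | P i) F i <= F j)%N.
Proof.
elim: r => // i r IH; rewrite inE big_cons => /predU1P[<- Pj|jr Pj].
  by rewrite Pj geq_minl.
by case: ifP => _; rewrite ?geq_min IH ?orbT.
Qed.

Section HittingFamily.

Variables (R : realType) (n k d s : nat) (H : {set 'I_n}).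
Hypotheses (cH : #|H| = s) (dk : (d < k)%N).

Definition hitting_family : {set {set 'I_n}} :=
  [set A : {set 'I_n} | (#|A| == k) && (A :&: H != set0)].

Lemma hitting_family_nu_star : nu_star R hitting_family <= s%:R.
Proof.
apply: ge_sup.
  exists 0; exists (fun=> 0); last by rewrite /weight_size big1.
  by split=> [A _|i]; rewrite ?lexx ?ler01 // big1 // ler01.
move=> _ [w [w01 w1] <-]; rewrite -cH -sumr_const.
apply: (@le_trans _ _ (\sum_(x in H) \sum_(A in hitting_family | x \in A) w A)); last first.
  by apply: ler_sum.
rewrite (exchange_big_dep (mem hitting_family)) /=; last by move=> x A _ /andP[].
apply: ler_sum => A AF; move: (AF); rewrite inE => /andP[_ /set0Pn[x]].
rewrite inE => /andP[xA xH]; rewrite (bigD1 x) /=; last by move: AF; rewrite xH xA andbT inE.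
have wA : 0 <= w A by case/andP: (w01 A AF).
by rewrite lerDl sumr_ge0.
Qed.

Lemma hitting_family_degree (S : {set 'I_n}) : #|S| = d ->
  ('C(n - d, k - d) - 'C(n - s - d, k - d) <= degree hitting_family S)%N.
Proof.
move=> cS.
have := @card_draws_superset _ S k; rewrite cS card_ord => <-; last exact: ltnW.
rewrite leq_subLR addnC -[leqLHS](cardsID [set A : {set 'I_n} | A :&: H != set0]) leq_add //.
  by apply: subset_leq_card; apply/subsetP => A; rewrite !inE => /andP[/andP[-> ->] ->].
case: (boolP (S :&: H == set0)) => [SH|/set0Pn[x /setIP[xS xH]]]; last first.
  rewrite [X in (X <= _)%N](_ : _ = 0%N) //; apply/eqP; rewrite cards_eq0 -subset0.
  apply/subsetP => A; rewrite !inE negbK => /andP[/eqP AH /andP[_ SA]].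
  have : x \in A :&: H by rewrite inE (subsetP SA) // xH.
  by rewrite AH inE.
have cHS : #|~: (H :|: S)| = (n - s - d)%N.
  by rewrite cardsCs setCK card_ord cardsU setIC (eqP SH) cards0 subn0 cH cS subnDA.
rewrite -cHS -cards_draws -(card_in_imset (f := fun A : {set 'I_n} => A :\: S)).
  apply: subset_leq_card; apply/subsetP => _ /imsetP[A + ->].
  rewrite !inE negbK => /andP[/eqP AH /andP[/eqP cA SA]].
  rewrite cardsDS // cA cS eqxx andbT setCU subsetI subsetDr andbT.
  by apply: subset_trans (subsetDl A S) _; rewrite -disjoints_subset -setI_eq0 AH.
move=> A B; rewrite !inE => /andP[_ /andP[_ SA]] /andP[_ /andP[_ SB]] eqD.
by rewrite -(setID A S) -(setID B S) eqD (setIidPr SA) (setIidPr SB).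
Qed.

End HittingFamily.

Unset Implicit Arguments.

Theorem corollary23 (R : realType) :
  exists s0 : nat, forall s : nat, (s0 <= s)%N ->
  forall n k d : nat,
    (0 < n)%N -> (0 < k)%N -> (1 <= d <= k - 1)%N -> (k * (s + 1) <= n)%N ->
    5 / 3 * (k%:R - d%:R) * s%:R - 2 / 3 * s%:R <= n%:R - d%:R :> R ->
    m_star R d n k s = ('C(n - d, k - d) - 'C(n - s - d, k - d))%N.
Proof.
exists 2000%N => s s2000 n k d n0 k0 /andP[d0 dk1] ksn ineq.
have dk : (d < k)%N by rewrite (leq_ltn_trans dk1) // subn1 ltn_predL.
have kn : (k <= n)%N by apply: leq_trans (leq_pmulr _ _) ksn; rewrite addn1.
have dn : (d <= n)%N by apply: leq_trans (ltnW dk) kn.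
have sn : (s <= n)%N by apply: leq_trans ksn; rewrite addn1 (leq_trans (leqnSn _)) // leq_pmull.
have ln : (5 * (k - d) * s <= 3 * (n - d) + 2 * s)%N.
  rewrite -(ler_nat R) natrD !natrM !natrB ?(ltnW dk) //.
  by move: ineq; move: n%:R k%:R d%:R s%:R => *; lra.
apply/eqP; rewrite eqn_leq; apply/andP; split.
  apply/bigmax_leqP => F /andP[/forall_inP unif nuF].
  have unif' A : A \in F -> #|A| = k by move=> /unif/eqP.
  have [|v [v0 cover sumv]] := @fractional_cover R n F.
    by apply/negP => /unif'; rewrite cards0 => k00; rewrite -k00 in k0.
  have [|S cS low] := @exists_top_set R _ (fun x => - v x) d; first by rewrite card_ord.
  apply: leq_trans (_ : degree F S <= _)%N.
    by apply: big_minn_le; rewrite ?mem_index_enum ?cS.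
  rewrite subnAC.
  have kn' : (k * s.+1 <= n)%N by rewrite -addn1.
  have low' x y : x \in S -> y \notin S -> v x <= v y by move=> xS yS; rewrite -lerN2 low.
  exact: (degree_le v0 (le_lt_trans sumv nuF) d0 dk kn' cS low' ln s2000 unif' cover).
pose H := [set widen_ord sn i | i : 'I_s].
have cH : #|H| = s.
  rewrite card_imset ?card_ord // => i j eqij; apply: val_inj.
  exact: (congr1 val eqij).
apply: (bigop.bigmax_sup (hitting_family k H)).
  rewrite (le_lt_trans (hitting_family_nu_star R k cH)) ?ltrDl // andbT.
  by apply/forall_inP => A; rewrite inE => /andP[].
have deg := hitting_family_degree cH dk.
rewrite /min_degree; elim/big_ind: _ => [|x y lx ly|S /eqP cS].
- have [S cS] : exists S : {set 'I_n}, #|S| = d.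
    have [|S cS _] := @exists_top_set R 'I_n (fun=> 0) d; first by rewrite card_ord.
    by exists S.
  apply: leq_trans (deg S cS) _; apply: subset_leq_card.
  by apply/subsetP => A; rewrite inE => /andP[].
- by rewrite leq_min lx ly.
- exact: deg.
Qed.
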